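(* Fix an integer $k \geq 2$. For every Markov Decision Process with $n$ states and $k$ actions per state, and every initial policy, the number of iterations performed by Greedy Policy Iteration is at most $$\frac{k}{k-1}\cdot\frac{k^n}{n} + o\!\left(\frac{k^n}{n}\right) \quad (n\to\infty).$$
   Context: A Markov Decision Process (MDP) has a set of states $\{1,\dots,n\}$ and, in every state, the same set of actions $\{1,\dots,k\}$. Each state–action pair $(s,a)$ determines a probability distribution over next states and a reward. A policy is a vector $\pi\in\{1,\dots,k\}^n$ (a stationary choice of one action per state); it induces a transition matrix $P^\pi$ and reward vector $r^\pi$. Its value vector $v^\pi\in\mathbb{R}^n$ is given by a standard infinite-horizon criterion, e.g. the average reward $v^\pi=\limsup_{N\to\infty}\frac1N\sum_{i=0}^{N-1}(P^\pi)^i r^\pi$ or the discounted reward with a fixed discount factor. Write $\pi'\succeq\pi$ if $v^{\pi'}(s)\ge v^\pi(s)$ for all $s$, and $\pi'\succ\pi$ if additionally strict inequality holds for at least one state. A collection $U$ of state–action pairs is well-defined if each state appears in it at most once; then $\pi\oplus U$ is the policy obtained from $\pi$ by setting the action at $s$ to $a$ for each $(s,a)\in U$. The improvement set of $\pi$ is $T^\pi=\{(s,a): \pi\oplus\{(s,a)\}\succ\pi\}$, and $S^\pi$ is the set of states appearing in $T^\pi$. Greedy Policy Iteration: start from a policy $\pi_0$; while $T^{\pi_i}\neq\emptyset$, choose a well-defined $U_i\subseteq T^{\pi_i}$ with $|U_i|=|S^{\pi_i}|$ (one pair for each improvement state) and set $\pi_{i+1}=\pi_i\oplus U_i$. *)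

(* Defs.v *)
From HB Require Import structures.
From mathcomp Require Import all_boot all_order all_algebra.
From mathcomp Require Import all_classical all_reals all_analysis.
Set Implicit Arguments.
Unset Strict Implicit.
Unset Printing Implicit Defensive.
Import Order.TTheory GRing.Theory Num.Theory.
Import numFieldNormedType.Exports.
Local Open Scope ring_scope.

Record MDP (R : realType) (n k : nat) := {
  trans : 'I_n -> 'I_k -> 'I_n -> R;
  reward : 'I_n -> 'I_k -> R;
  trans_ge0 : forall s a t, 0 <= trans s a t;
  trans_sum1 : forall s a, \sum_(t < n) trans s a t = 1 }.

Inductive criterion (R : realType) :=
  | Average
  | Discounted (gamma : R) of 0 <= gamma < 1.
Arguments Average {R}.

Definition policy (n k : nat) := {ffun 'I_n -> 'I_k}.

Section Values.
Variables (R : realType) (n k : nat) (M : MDP R n k).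
Implicit Types (c : criterion R) (pi : policy n k).

Definition trans_mx pi : 'M[R]_n := \matrix_(s, t) trans M s (pi s) t.

Definition reward_vec pi : 'cV[R]_n := \col_s reward M s (pi s).

(* Expected reward collected at time [i] when starting from [s]. *)
Definition step_reward pi (s : 'I_n) (i : nat) : R :=
  (trans_mx pi ^+ i *m reward_vec pi) s 0.

Definition value c pi (s : 'I_n) : R :=
  match c with
  | Average => limn_sup (fun N => N%:R^-1 * \sum_(i < N) step_reward pi s i)
  | Discounted gamma _ =>
      limn (series (fun i => gamma ^+ i * step_reward pi s i))
  end.

Definition dominates c (pi' pi : policy n k) : bool :=
  [forall s, value c pi s <= value c pi' s].

Definition strictly_dominates c (pi' pi : policy n k) : bool :=
  dominates c pi' pi && [exists s, value c pi s < value c pi' s].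

Definition well_defined (U : {set 'I_n * 'I_k}) : bool :=
  [forall s, #|[set a | (s, a) \in U]| <= 1]%N.

(* Meaningful for well-defined [U], where the picked action is unique. *)
Definition switch pi (U : {set 'I_n * 'I_k}) : policy n k :=
  [ffun s => odflt (pi s) [pick a | (s, a) \in U]].

Definition improvement_set c pi : {set 'I_n * 'I_k} :=
  [set u | strictly_dominates c (switch pi [set u]) pi].

Definition improvement_states c pi : {set 'I_n} :=
  [set u.1 | u in improvement_set c pi].

(* One iteration of Greedy Policy Iteration.  It is a relation because the
   improving pair chosen in each improvement state is arbitrary. *)
Definition greedy_step c : rel (policy n k) := fun pi pi' =>
  (improvement_set c pi != finset.set0) &&
  [exists U : {set 'I_n * 'I_k},
     [&& well_defined U, U \subset improvement_set c pi,
         #|U| == #|improvement_states c pi| & pi' == switch pi U]].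

(* [pi0 :: run] lists the successive policies, so [size run] iterations are
   performed.  Halting of the last policy is not required: bounding unfinished
   executions as well is what excludes infinite ones. *)
Definition GPI_run c (pi0 : policy n k) (run : seq (policy n k)) : bool :=
  path (greedy_step c) pi0 run.

End Values.

(* Main.v *)
(** Call a state sharp for a policy when some action there improves the policy
    in Howard's sense: for the average criterion, the action increases the
    expected gain, or preserves it and increases gain plus bias.  Sharp states
    include the improvement states, strictly so for multichain problems, where a
    bias improvement at a state that becomes transient leaves the gain unchanged.

    If the i-th policy has d improvement states and d + e sharp states, undoing
    the d switches one by one in a suitable order gives d policies strictly above
    the i-th and at most the (i+1)-st, and switching one of the e other sharp
    states gives e policies with the same value as the i-th.  Up to one policy
    per iteration, all these are distinct, so the number of sharp states minus
    one, summed over the run, is at most k^n.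

    A later policy of the run never lies in the box of the policies that use no
    sharp action of an earlier one.  The indicators of the boxes are therefore
    linearly independent, and at most #{b | b has at most D nonzero coordinates}
    iterations have at most D sharp states.  For D slightly below n (k-1)/k this
    is exponentially smaller than k^n, by Chernoff's bound. *)
Require Import Defs.
From mathcomp Require Import all_boot all_order all_algebra.
From mathcomp Require Import all_classical all_reals all_analysis.
From mathcomp Require Import ring lra zify.
Set Implicit Arguments.
Unset Strict Implicit.
Unset Printing Implicit Defensive.
Import Order.TTheory GRing.Theory Num.Theory.
Import numFieldNormedType.Exports.
Local Open Scope ring_scope.

(** * Charging policies to the iterations *)

Section Combinatorics.
Variables (n k : nat).
Implicit Types (pi sg rho : policy n k) (s : 'I_n) (a : 'I_k) (Z : {set 'I_n}).

Definition upd pi s a : policy n k := [ffun t => if t == s then a else pi t].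

Definition mix pi sg Z : policy n k := [ffun s => if s \in Z then sg s else pi s].

Definition diffs pi sg : {set 'I_n} := [set s | pi s != sg s]%SET.

Lemma upd_self pi s : upd pi s (pi s) = pi.
Proof. by apply/ffunP => t; rewrite ffunE; case: eqP => // ->. Qed.

Lemma diffs_eq0 pi sg : (diffs pi sg == finset.set0) = (pi == sg).
Proof.
apply/eqP/eqP => [/setP h|->]; last by apply/setP => s; rewrite !inE eqxx.
by apply/ffunP => s; have := h s; rewrite !inE => /negbFE/eqP.
Qed.

Lemma diffs_sym pi sg : diffs pi sg = diffs sg pi.
Proof. by apply/setP => s; rewrite !inE eq_sym. Qed.

Lemma diffs_upd pi s a : a != pi s -> diffs pi (upd pi s a) = [set s]%SET.
Proof.
move=> h; apply/setP => t; rewrite !inE ffunE.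
by case: (eqVneq t s) => [->|]; rewrite ?eqxx // eq_sym h.
Qed.

Lemma diffs_mixl pi sg Z : Z \subset diffs pi sg -> diffs pi (mix pi sg Z) = Z.
Proof.
move=> /fintype.subsetP h; apply/setP => s; rewrite !inE ffunE.
by case: ifP => [/h|]; rewrite ?inE ?eqxx // => ->.
Qed.

Lemma diffs_mixr pi sg Z :
  diffs (mix pi sg Z) sg = diffs pi sg :\: Z.
Proof.
by apply/setP => s; rewrite !inE ffunE; case: ifP => //=; rewrite eqxx.
Qed.

Definition support (dflt : 'I_k) (b : policy n k) : {set 'I_n} :=
  [set s | b s != dflt]%SET.

Definition slt (le : rel (policy n k)) : rel (policy n k) :=
  fun pi sg => le pi sg && ~~ le sg pi.

(* [le pi sg] reads "[sg] is at least as good as [pi]" and [W pi] is a superset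
   of the improvement set of [pi].  For the average criterion a strict superset
   is needed for [no_sharp_le] to hold. *)
Record improvement_order (le : rel (policy n k))
    (W : policy n k -> 'I_n -> 'I_k -> bool) : Prop := ImprovementOrder {
  io_refl : reflexive le;
  io_trans : transitive le;
  sharp_self : forall pi s, W pi s (pi s) = false;
  sharp_le : forall pi s a, W pi s a -> le pi (upd pi s a);
  no_sharp_le : forall pi sg, (forall s, ~~ W pi s (sg s)) -> le sg pi;
  switch_lt : forall pi sg, pi != sg ->
    (forall s, pi s != sg s -> slt le pi (upd pi s (sg s))) -> slt le pi sg }.

Section Order.
Variables (le : rel (policy n k)) (W : policy n k -> 'I_n -> 'I_k -> bool).
Hypothesis ord : improvement_order le W.
Let lt := slt le.

Definition sharp_states pi : {set 'I_n} := [set s | [exists a, W pi s a]]%SET.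

Definition improving_states pi : {set 'I_n} :=
  [set s | [exists a, lt pi (upd pi s a)]]%SET.

Lemma improving_sharp pi s a : lt pi (upd pi s a) -> W pi s a.
Proof.
apply: contraTT => h; rewrite /lt /slt negb_and negbK; apply/orP; right.
apply: (no_sharp_le ord) => t; rewrite ffunE; case: eqP => [->//|_].
by rewrite (sharp_self ord).
Qed.

(** A single switch is always comparable with [pi]: a sharp action does not lower the value, any
    other action does not raise it. *)
Lemma not_improving_le pi s a : ~~ lt pi (upd pi s a) -> le (upd pi s a) pi.
Proof.
move=> h; have [/(sharp_le ord) h1|h1] := boolP (W pi s a).
  by move: h; rewrite /lt /slt h1 negbK.
apply: (no_sharp_le ord) => t; rewrite ffunE; case: eqP => [->//|_].
by rewrite (sharp_self ord).
Qed.

Lemma improving_subset pi : improving_states pi \subset sharp_states pi.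
Proof.
apply/fintype.subsetP => s; rewrite !inE => /existsP[a /improving_sharp h].
by apply/existsP; exists a.
Qed.

Definition greedy pi sg : Prop :=
  [/\ pi != sg, diffs pi sg = improving_states pi
    & forall s, pi s != sg s -> lt pi (upd pi s (sg s))].

Lemma greedy_lt pi sg : greedy pi sg -> lt pi sg.
Proof. by case=> h _ /(switch_lt ord); apply. Qed.

Lemma slt_le_trans pi rho sg : lt pi rho -> le rho sg -> lt pi sg.
Proof.
move=> /andP[h1 h2] h3; apply/andP; split; first exact: io_trans ord _ _ _ h1 h3.
by apply: contra h2 => h; apply: io_trans ord _ _ _ h3 h.
Qed.

Lemma le_slt_trans pi rho sg : le pi rho -> lt rho sg -> lt pi sg.
Proof.
move=> h1 /andP[h2 h3]; apply/andP; split; first exact: io_trans ord _ _ _ h1 h2.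
by apply: contra h3 => h; apply: io_trans ord _ _ _ h h1.
Qed.

Lemma slt_irr pi : lt pi pi = false.
Proof. by rewrite /lt /slt andbN. Qed.

Lemma lt_mix pi sg Z : Z != finset.set0 -> Z \subset diffs pi sg ->
  (forall s, pi s != sg s -> lt pi (upd pi s (sg s))) -> lt pi (mix pi sg Z).
Proof.
move=> Z0 ZD h; have dZ := diffs_mixl ZD.
apply: (switch_lt ord); first by rewrite -diffs_eq0 dZ.
move=> s; have : (s \in diffs pi (mix pi sg Z)) = (s \in Z) by rewrite dZ.
rewrite inE => -> sZ; rewrite ffunE sZ; apply: h.
by have /fintype.subsetP/(_ s sZ) := ZD; rewrite inE.
Qed.

(* If every single undo were improving, undoing all of [Z] would be too. *)
Lemma undo_one pi sg Z : Z != finset.set0 -> Z \subset diffs pi sg ->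
  (forall s, pi s != sg s -> lt pi (upd pi s (sg s))) ->
  exists2 s, s \in Z & le (mix pi sg (Z :\ s)) (mix pi sg Z).
Proof.
move=> Z0 ZD h; set tau := mix pi sg Z.
have ltt : lt pi tau by exact: lt_mix.
have [/existsP[s /andP[sZ hs]]|] :=
    boolP [exists s, (s \in Z) && ~~ lt tau (upd tau s (pi s))].
  exists s => //; suff -> : mix pi sg (Z :\ s) = upd tau s (pi s).
    exact: not_improving_le.
  by apply/ffunP => t; rewrite !ffunE !inE; case: eqP => [->|].
rewrite negb_exists => /forallP hall; exfalso.
suff /(fun x => slt_le_trans x (proj1 (andP ltt))) : lt tau pi by rewrite slt_irr.
apply: (switch_lt ord); first by apply: contraTneq ltt => <-; rewrite slt_irr.
move=> s; rewrite ffunE; case: ifP => [sZ _|]; last by rewrite eqxx.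
by have := hall s; rewrite sZ negbK.
Qed.

(** Iterating [undo_one] removes the switches one at a time without ever raising the value. *)
Lemma chain pi sg : (forall s, pi s != sg s -> lt pi (upd pi s (sg s))) ->
  forall Z, Z \subset diffs pi sg -> forall j, (j <= #|Z|)%N ->
  exists Z', [/\ Z' \subset Z, #|Z'| = j & le (mix pi sg Z') (mix pi sg Z)].
Proof.
move=> h Z; have [d] := ubnP #|Z|; elim: d Z => // d IH Z Zd ZD j.
rewrite leq_eqVlt => /predU1P[->|jZ].
  by exists Z; split=> //; apply: io_refl ord _.
have Z0 : Z != finset.set0 by rewrite -card_gt0; apply: leq_ltn_trans jZ.
have [s sZ hs] := undo_one Z0 ZD h.
have cZ := cardsD1 s Z; rewrite sZ in cZ.
have [|||Z' [Z'Z <- hZ']] := IH (Z :\ s) _ _ j; [lia| |lia|].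
  exact: fintype.subset_trans (subD1set _ _) ZD.
exists Z'; split=> //; last exact: io_trans ord _ _ _ hZ' hs.
exact: fintype.subset_trans Z'Z (subD1set _ _).
Qed.

(* Policies charged to the iteration [pi] -> [sg].  Dropping those at Hamming
   distance 1 from [sg] keeps them disjoint from the second kind charged to the
   next iteration. *)
Definition above pi sg : {set policy n k} :=
  [set rho | [&& lt pi rho, le rho sg & #|diffs rho sg| != 1%N]]%SET.

Definition beside pi : {set policy n k} :=
  [set rho | [&& le pi rho, le rho pi & #|diffs pi rho| == 1%N]]%SET.

Definition charged pi sg : {set policy n k} := above pi sg :|: beside pi.

(** Keeping [d - e] of the [d] switches leaves Hamming distance [e] to [sg], so [chain] yields a
    policy for each [e < d], and the distances tell them apart. Only [e = 1] is lost. *)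
Lemma card_above pi sg : greedy pi sg -> (#|improving_states pi|.-1 <= #|above pi sg|)%N.
Proof.
move=> [neq dE h]; set d := #|improving_states pi|.
have dn : (d <= n)%N by rewrite -[X in (_ <= X)%N]card_ord; apply: max_card.
have mixD : mix pi sg (diffs pi sg) = sg.
  by apply/ffunP => s; rewrite ffunE inE; case: eqP.
pose dist (rho : policy n k) : 'I_n.+1 := inord #|diffs rho sg|.
have ex (e : nat) : (e < d)%N -> e != 1%N ->
    exists2 rho, rho \in above pi sg & #|diffs rho sg| = e.
  move=> ed e1; have [|Z [ZD cZ leZ]] := chain h (fintype.subxx _) (j := (d - e)%N).
    by rewrite dE -/d; lia.
  have cE : #|diffs (mix pi sg Z) sg| = e.
    by rewrite diffs_mixr cardsDS // dE -/d cZ; lia.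
  exists (mix pi sg Z) => //; rewrite inE cE e1 andbT -[X in le _ X]mixD leZ andbT.
  by apply: lt_mix => //; rewrite -card_gt0 cZ; lia.
have sub : [set e : 'I_n.+1 | (e < d)%N && (e != 1%N :> nat)]%SET
    \subset [set dist rho | rho in above pi sg]%SET.
  apply/fintype.subsetP => e; rewrite inE => /andP[ed e1].
  have [rho hr hd] := ex e ed e1; apply/imsetP; exists rho => //.
  by apply/val_inj; rewrite /dist hd inord_val.
apply: leq_trans (leq_trans (subset_leq_card sub) (leq_imset_card _ _)).
have hn : (1 <= n)%N.
  by move: neq; rewrite -diffs_eq0 -card_gt0 dE => /leq_trans; apply.
pose one : 'I_n.+1 := inord 1.
have -> : [set e : 'I_n.+1 | (e < d)%N && (e != 1%N :> nat)]%SET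
    = [set e : 'I_n.+1 | (e < d)%N]%SET :\ one.
  by apply/setP => e; rewrite !inE andbC -val_eqE /= inordK.
have c1 : #|[set e : 'I_n.+1 | (e < d)%N]%SET| = d.
  by rewrite -sum1dep_card -(big_ord_widen n.+1 (fun=> 1%N)) ?sum1_card ?card_ord //; lia.
by have := cardsD1 one [set e : 'I_n.+1 | (e < d)%N]%SET; rewrite c1; lia.
Qed.

(** A sharp action at a state that is not improving leaves the value unchanged, and the state is
    recovered as the only difference with [pi]. *)
Lemma card_beside pi :
  (#|sharp_states pi| - #|improving_states pi| <= #|beside pi|)%N.
Proof.
rewrite -cardsDS ?improving_subset //.
pose f s := odflt pi [pick rho | (rho \in beside pi) && (diffs pi rho == [set s]%SET)].
have fP s : s \in sharp_states pi :\: improving_states pi ->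
    f s \in beside pi /\ diffs pi (f s) = [set s]%SET.
  move=> hs; have : (s \notin improving_states pi) && (s \in sharp_states pi).
    by move: hs; rewrite finset.in_setD.
  rewrite inE negb_exists => /andP[/forallP h1]; rewrite inE => /existsP[a h2].
  rewrite /f; case: pickP => [rho /andP[h3 /eqP h4]|/(_ (upd pi s a))]; first by split.
  have ha : a != pi s by apply: contraTneq h2 => ->; rewrite (sharp_self ord).
  rewrite inE diffs_upd // cards1 !eqxx (sharp_le ord h2) !andbT.
  by rewrite not_improving_le.
rewrite -(card_in_imset (f := f)).
  by apply/subset_leq_card/fintype.subsetP => _ /imsetP[s /fP[? _] ->].
move=> s t /fP[_ hs] /fP[_ ht] e; apply/set1P.
by rewrite -ht -e hs inE.
Qed.

Lemma card_charged pi sg : greedy pi sg ->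
  (#|sharp_states pi|.-1 <= #|charged pi sg|)%N.
Proof.
move=> g; have h1 := card_above g; have h2 := card_beside pi.
have h3 := subset_leq_card (improving_subset pi).
rewrite cardsU; suff -> : above pi sg :&: beside pi = finset.set0.
  by rewrite cards0; lia.
apply/setP => rho; rewrite !inE; apply/negP => /andP[/and3P[h _ _] /and3P[_ h' _]].
by have := slt_le_trans h h'; rewrite slt_irr.
Qed.

Section Run.
Variables (m : nat) (p : nat -> policy n k).
Hypothesis run : forall i, (i < m)%N -> greedy (p i) (p i.+1).

Lemma run_le i j : (i <= j <= m)%N -> le (p i) (p j).
Proof.
elim: j => [|j IH] /andP[ij jm]; first by move: ij; case: i => // _; apply: io_refl ord _.
move: ij; rewrite leq_eqVlt => /predU1P[->|ij]; first exact: io_refl ord _.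
have /andP[h _] := greedy_lt (run jm).
by apply: io_trans ord _ _ _ _ h; apply: IH; lia.
Qed.

Lemma run_lt i j : (i < j <= m)%N -> lt (p i) (p j).
Proof.
move=> /andP[ij jm]; have h := greedy_lt (run (leq_trans ij jm)).
by apply: slt_le_trans h _; apply: run_le; lia.
Qed.

(** Policies charged to [i] are at most [p i.+1], those charged to [j] at least [p j]. A common one
    forces [j = i.+1], above [p i] and beside [p j], where the Hamming distances differ. *)
Lemma charged_disjoint i j rho : (i < j < m)%N ->
  rho \in charged (p i) (p i.+1) -> rho \in charged (p j) (p j.+1) -> False.
Proof.
move=> /andP[ij jm]; rewrite !inE => /orP[] /and3P[h1 h2 h3] hj.
  have hle : le (p i.+1) (p j) by apply: run_le; lia.
  case/orP: hj => /and3P[g1 g2 g3].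
    have := slt_le_trans (le_slt_trans hle g1) h2; by rewrite slt_irr.
  move: ij; rewrite leq_eqVlt => /predU1P[e|ij].
    by move: h3; rewrite e diffs_sym g3.
  have hl : lt (p i.+1) (p j) by apply: run_lt; lia.
  by have := le_slt_trans (io_trans ord g1 h2) hl; rewrite slt_irr.
have hl : lt (p i) (p j) by apply: run_lt; lia.
have hr : le (p j) rho by case/orP: hj => /and3P[] // /andP[].
by have := slt_le_trans (slt_le_trans hl hr) h2; rewrite slt_irr.
Qed.

Lemma sum_sharp : (\sum_(i < m) #|sharp_states (p i)|.-1 <= k ^ n)%N.
Proof.
apply: (@leq_trans (\sum_(i < m) #|charged (p i) (p i.+1)|)).
  by apply: leq_sum => i _; apply: card_charged; apply: run.
have -> : (k ^ n = #|{: policy n k}|)%N by rewrite card_ffun !card_ord.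
under eq_bigr do rewrite -sum1_card.
rewrite pair_big_dep /= sum1dep_card.
rewrite -(card_in_imset (f := snd)).
  exact: max_card.
move=> [i r] [j r']; rewrite inE /= => hi; rewrite inE /= => hj e; subst r'.
congr pair.
apply/val_inj => /=; have [ij|ij|//] := ltngtP i j; exfalso.
  by apply: (charged_disjoint _ hi hj); rewrite ij ltn_ord.
by apply: (charged_disjoint _ hj hi); rewrite ij ltn_ord.
Qed.

Lemma run_sharp i j : (i < j <= m)%N -> exists s, W (p i) s (p j s).
Proof.
move=> ij; apply/existsP; apply: contraTT (run_lt ij).
rewrite negb_exists => /forallP /(no_sharp_le ord) h.
by rewrite /lt /slt h andbF.
Qed.

End Run.
End Order.
End Combinatorics.

(** * Iterations with few sharp states *)

Section Counting.
Variables (n k : nat) (dflt : 'I_k).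
Implicit Types (b y : policy n k).

Definition small_support D : {set policy n k} :=
  [set b | (#|support dflt b| <= D)%N]%SET.

(* The indicators of the boxes span a triangular system, and an indicator
   depending on at most [D] coordinates is a combination of the products
   [prod_(s in support b) [y s = b s]] with [b] of support at most [D]. *)
Lemma card_skew_boxes D q (x : 'I_q -> policy n k) (B : 'I_q -> 'I_n -> pred 'I_k) :
  (forall i s, B i s (x i s)) ->
  (forall i j : 'I_q, (i < j)%N -> exists s, ~~ B i s (x j s)) ->
  (forall i, (#|[set s | [exists a, ~~ B i s a]]%SET| <= D)%N) ->
  (q <= #|small_support D|)%N.
Proof.
move=> Bx Bskew BD.
(* The coefficients expand the indicator of [B i s] in the basis made of the constant 1 and the
   indicators of the actions other than [dflt]. *)
pose c i s a : rat :=
  if a == dflt then (B i s dflt)%:R else (B i s a)%:R - (B i s dflt)%:R.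
pose e b y : rat := \prod_s ((b s == dflt) || (y s == b s))%:R.
have cE i s (t : 'I_k) :
    (B i s t)%:R = \sum_a c i s a * ((a == dflt) || (t == a))%:R :> rat.
  rewrite (bigD1 dflt) //= /c eqxx mulr1.
  have [->|tn] := eqVneq t dflt.
    rewrite big1 ?addr0 // => a /negbTE an.
    by rewrite an (eq_sym dflt) an mulr0.
  rewrite (bigD1 t) //= (negbTE tn) eqxx mulr1 big1; first by rewrite addr0 addrC subrK.
  by move=> a /andP[/negbTE -> /negbTE]; rewrite eq_sym => -> /=; rewrite mulr0.
have boxE i y : \prod_s (B i s (y s))%:R =
    \sum_(b in small_support D) (\prod_s c i s (b s)) * e b y.
  under eq_bigr do rewrite cE.
  rewrite (bigA_distr_bigA (fun s a => c i s a * ((a == dflt) || (y s == a))%:R)).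
  rewrite (bigID (mem (small_support D))) /= [X in _ + X]big1 ?addr0.
    by apply: eq_bigr => b _; rewrite big_split.
  move=> b; rewrite inE -ltnNge => hb.
  (* A support with more than [D] states contains one where the box allows every action; the
     coefficient there is [1 - 1 = 0]. *)
  have /subsetPn[s sb] : ~~ (support dflt b \subset [set s | [exists a, ~~ B i s a]]%SET).
    apply: contraL hb => /subset_leq_card h.
    by rewrite -leqNgt; apply: leq_trans h (BD i).
  rewrite inE negb_exists => /forallP Bs; rewrite inE in sb.
  rewrite (bigD1 s) //= /c (negbTE sb).
  by rewrite (negbNE (Bs _)) (negbNE (Bs _)) subrr !mul0r.
(* [F] is triangular with unit diagonal, hence of rank [q], yet it factors through dimension
   [#|small_support D|]. *)
pose F : 'M[rat]_q := \matrix_(i, j) \prod_s (B i s (x j s))%:R.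
pose C : 'M[rat]_(q, #|small_support D|) :=
  \matrix_(i, l) \prod_s c i s ((enum_val l : policy n k) s).
pose E : 'M[rat]_(#|small_support D|, q) :=
  \matrix_(l, j) e (enum_val l) (x j).
have FE : F = C *m E.
  apply/matrixP => i j; rewrite !mxE boxE big_enum_val.
  by apply: eq_bigr => l _; rewrite !mxE.
have Ftrig : is_trig_mx F.
  apply/is_trig_mxP => i j ij; rewrite mxE.
  by have [s /negbTE hs] := Bskew i j ij; rewrite (bigD1 s) //= hs mul0r.
have Funit : F \in unitmx.
  rewrite unitmxE (det_trig Ftrig) big1 ?unitr1 // => i _.
  by rewrite mxE big1 // => s _; rewrite Bx.
by rewrite -{1}(mxrank_unit Funit) FE mulmx_max_rank.
Qed.

Variables (le : rel (policy n k)) (W : policy n k -> 'I_n -> 'I_k -> bool).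
Hypothesis ord : improvement_order le W.
Variables (m : nat) (p : nat -> policy n k).
Hypothesis run : forall i, (i < m)%N -> greedy le (p i) (p i.+1).

(** Each selected policy gets the box of policies avoiding its sharp actions. The box contains that
    policy, and [run_sharp] keeps the later ones out. *)
Lemma card_few_sharp D :
  (\sum_(i < m) (#|sharp_states W (p i)| <= D) <= #|small_support D|)%N.
Proof.
pose r := [seq i <- iota 0 m | #|sharp_states W (p i)| <= D]%N.
have -> : (\sum_(i < m) (#|sharp_states W (p i)| <= D) = size r)%N.
  rewrite size_filter -sum1_count [RHS]big_mkcond -(big_mkord xpredT
    (fun i => nat_of_bool (#|sharp_states W (p i)| <= D)%N)) /index_iota subn0.
  by apply: eq_bigr => i _; case: ifP.
have rs : sorted ltn r by apply: (sorted_filter ltn_trans); apply: iota_ltn_sorted.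
have rin (i : 'I_(size r)) :
    (nth 0%N r i < m)%N /\ (#|sharp_states W (p (nth 0%N r i))| <= D)%N.
  have := mem_nth 0%N (ltn_ord i); rewrite mem_filter mem_iota add0n.
  by case/andP.
apply: (card_skew_boxes (x := fun i => p (nth 0%N r i))
  (B := fun i s a => ~~ W (p (nth 0%N r i)) s a)).
- by move=> i s; rewrite (sharp_self ord).
- move=> i j ij; have hlt : (nth 0 r i < nth 0 r j)%N.
    by apply: (sorted_ltn_nth ltn_trans) => //; rewrite inE.
  have [|s hs] := run_sharp ord run (i := nth 0%N r i) (j := nth 0%N r j).
    by rewrite hlt ltnW // (rin j).1.
  by exists s; rewrite negbK.
- move=> i; apply: leq_trans (rin i).2; apply/subset_leq_card/fintype.subsetP => s.
  by rewrite !inE => /existsP[a]; rewrite negbK => h; apply/existsP; exists a.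
Qed.

Lemma greedy_run_bound D : (0 < D)%N -> (m <= k ^ n %/ D + #|small_support D|)%N.
Proof.
move=> D0; set few := (\sum_(i < m) (#|sharp_states W (p i)| <= D))%N.
have h1 : ((m - few) * D <= k ^ n)%N.
  apply: leq_trans (sum_sharp ord run).
  rewrite mulnBl leq_subLR /few big_distrl /= -big_split /=.
  rewrite -[X in (X * _ <= _)%N]card_ord -sum_nat_const; apply: leq_sum => i _.
  by case: leqP => /=; lia.
have h2 := card_few_sharp D; rewrite -/few in h2.
have h3 : (m - few <= k ^ n %/ D)%N by rewrite leq_divRL.
lia.
Qed.

End Counting.

(** * Finite Markov chains *)

Section Markov.
Variables (R : realType) (n : nat).
Implicit Types (P Q H : 'M[R]_n) (x y z r g h : 'cV[R]_n) (s t u v : 'I_n).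

Definition stochastic P : Prop :=
  (forall s t, 0 <= P s t) /\ (forall s, \sum_t P s t = 1).

Definition lev x y : Prop := forall s, x s 0 <= y s 0.

Lemma nat_mul_bounded_le0 (a K : R) : (forall N : nat, N%:R * a <= K) -> a <= 0.
Proof.
move=> h; rewrite leNgt; apply/negP => a0.
have := h (Num.truncn (K / a)).+1.
by rewrite leNgt -ltr_pdivrMr // truncnS_gt.
Qed.

Lemma mulmx_le P x y : stochastic P -> lev x y -> lev (P *m x) (P *m y).
Proof.
move=> [P0 _] h s; rewrite !mxE; apply: ler_sum => t _.
by apply: ler_wpM2l; [exact: P0 | exact: h].
Qed.

Lemma mulmx_const P (K : R) : stochastic P -> P *m const_mx K = const_mx K :> 'cV_n.
Proof.
move=> [_ P1]; apply/matrixP => s t; rewrite !mxE.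
by under eq_bigr do rewrite mxE; rewrite -mulr_suml P1 mul1r.
Qed.

Lemma mulmx_norm_le P x (K : R) : stochastic P -> (forall s, `|x s 0| <= K) ->
  forall s, `|(P *m x) s 0| <= K.
Proof.
move=> Ps h s; have e K' : (P *m const_mx K' : 'cV_n) s 0 = K'.
  by rewrite mulmx_const // mxE.
rewrite ler_norml; apply/andP; split; [rewrite -(e (- K)) | rewrite -(e K)].
  by apply: mulmx_le => // t; have := h t; rewrite mxE ler_norml => /andP[].
by apply: mulmx_le => // t; have := h t; rewrite mxE ler_norml => /andP[].
Qed.

Lemma expmx_norm_le P x (K : R) (N : nat) : stochastic P ->
  (forall s, `|x s 0| <= K) -> forall s, `|(P ^+ N *m x) s 0| <= K.
Proof.
move=> Ps; elim: N x => [|N IH] x h s; first by rewrite expr0 mul1mx.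
by rewrite exprSr -mulmxE -mulmxA; apply: IH; apply: mulmx_norm_le.
Qed.

Lemma col_bounded x : exists K, forall s, `|x s 0| <= K.
Proof.
exists (\sum_s `|x s 0|) => s; rewrite (bigD1 s) //= lerDl.
by apply: sumr_ge0.
Qed.

Lemma expmx_le P x (N : nat) : stochastic P -> lev (P *m x) x -> lev (P ^+ N *m x) x.
Proof.
move=> Ps h; elim: N => [|N IH] s; first by rewrite expr0 mul1mx.
rewrite exprSr -mulmxE -mulmxA; apply: le_trans (IH s).
elim: N {IH} x h s => [|N IH] x h s; first by rewrite expr0 !mul1mx.
by rewrite exprSr -mulmxE -!mulmxA; apply: IH; apply: mulmx_le.
Qed.

(** Here [z] is in the kernel and in the image of [1 - P]. Then [P ^+ N *m y = y - z *+ N] stays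
    bounded in [N], which forces [z = 0]. *)
Lemma sub1mx_fix_eq0 P y z : stochastic P -> z = (1%:M - P) *m y ->
  P *m z = z -> z = 0.
Proof.
move=> Ps zE Pz.
have powE (N : nat) : P ^+ N *m y = y - z *+ N.
  elim: N => [|N IH]; first by rewrite expr0 mul1mx subr0.
  have Py : P *m y = y - z by rewrite zE mulmxBl mul1mx subKr.
  by rewrite exprS -mulmxE -mulmxA IH mulmxBr raddfMn /= Pz Py mulrS opprD addrA.
have [K yK] := col_bounded y.
have zK s (N : nat) : N%:R * `|z s 0| <= K + K.
  have := expmx_norm_le N Ps yK s; rewrite powE !mxE mulmxnE => h.
  rewrite -[N%:R]ger0_norm // -normrM mulr_natl.
  have -> : z s 0 *+ N = y s 0 - (y s 0 - z s 0 *+ N) by rewrite subKr.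
  by apply: le_trans (ler_normB _ _) (lerD (yK s) h).
apply/matrixP => s j; rewrite ord1 [RHS]mxE; apply/eqP; rewrite -normr_le0.
exact: nat_mul_bounded_le0 (zK s).
Qed.

Lemma sub1mx_fix_mx_eq0 P (Y Z : 'M[R]_n) : stochastic P ->
  Z = (1%:M - P) *m Y -> P *m Z = Z -> Z = 0.
Proof.
move=> Ps ZE PZ; apply/matrixP => s t.
have : col t Z = 0.
  apply: (@sub1mx_fix_eq0 P (col t Y)) => //.
    by rewrite {1}ZE !colE mulmxA.
  by rewrite colE mulmxA PZ.
by move=> /matrixP/(_ s 0); rewrite !mxE.
Qed.

(* [Q] is the Cesaro limit of the powers of [P] and [H] is a deviation matrix:
   for a reward vector [r], [Q *m r] is the gain and [H *m r] a bias. *)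
Definition cesaro_pair P Q H : Prop :=
  P *m Q = Q /\ 1%:M = Q + (1%:M - P) *m H.

(* Boundedness of the powers of [P] makes the kernel and the image of [1 - P]
   complementary. *)
Lemma cesaro_pair_exists P : stochastic P -> exists Q H, cesaro_pair P Q H.
Proof.
(* The transpose turns the column kernel and image of [1 - P] into row spaces. *)
move=> Ps; pose B := (1%:M - P)^T.
have cap0 : (kermx B :&: B)%MS = 0.
  apply/eqP/rowV0P => v; rewrite sub_capmx => /andP[/sub_kermxP vB /submxP[D vD]].
  apply: trmx_inj; rewrite trmx0; apply: (@sub1mx_fix_eq0 P D^T) => //.
    by rewrite vD trmx_mul trmxK.
  move/(congr1 trmx): vB; rewrite trmx_mul trmxK trmx0 mulmxBl mul1mx.
  by move/eqP; rewrite subr_eq0 eq_sym => /eqP.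
have : row_full (kermx B + B)%MS.
  by rewrite /row_full (mxrank_disjoint_sum cap0) mxrank_ker subnK // rank_leq_row.
rewrite -sub1mx => /sub_addsmxP[[u1 u2] /= e].
exists (u1 *m kermx B)^T, u2^T; split.
  apply/eqP; rewrite eq_sym -subr_eq0 -{1}[_^T]mul1mx -mulmxBl.
  by rewrite -[1%:M - P]trmxK -trmx_mul -mulmxA mulmx_ker mulmx0 trmx0.
by rewrite -[1%:M - P]trmxK -trmx_mul -linearD /= -e trmx1.
Qed.

Section Cesaro.
Variables (P Q H : 'M[R]_n).
Hypotheses (Ps : stochastic P) (PQH : cesaro_pair P Q H).

(** [Q - Q P] is fixed by [P]; multiplying [1 = Q + (1 - P) H] by [1 - P] on the right puts it in
    the image of [1 - P] as well. *)
Lemma cesaro_mulmx_fix : Q *m P = Q.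
Proof.
have [PQ e] := PQH.
apply/eqP; rewrite eq_sym -subr_eq0 -{1}[Q]mulmx1 -mulmxBr; apply/eqP.
apply: (@sub1mx_fix_mx_eq0 P (1%:M - H *m (1%:M - P))) => //; last by rewrite mulmxA PQ.
have e' : 1%:M - P = Q *m (1%:M - P) + (1%:M - P) *m H *m (1%:M - P).
  by rewrite -mulmxDl -e mul1mx.
by rewrite [in RHS]mulmxBr mulmx1 mulmxA; apply/eqP; rewrite eq_sym subr_eq -e'.
Qed.

(** Telescoping of [x = Q x + (H x - P H x)], where [Q x] is fixed by [P]. *)
Lemma sum_expmx x (N : nat) :
  \sum_(i < N) P ^+ i *m x = (Q *m x) *+ N + (H *m x - P ^+ N *m (H *m x)).
Proof.
have [PQ e] := PQH; elim: N => [|N IH].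
  by rewrite big_ord0 mulr0n add0r expr0 mul1mx subrr.
rewrite big_ord_recr /= IH mulrSr -!addrA; congr (_ + _).
have powQ M : P ^+ M *m Q = Q.
  by elim: M => [|M IHM]; rewrite ?expr0 ?mul1mx // exprSr -mulmxE -mulmxA PQ.
have -> : P ^+ N *m x = Q *m x + (P ^+ N *m (H *m x) - P ^+ N.+1 *m (H *m x)).
  have xE : x = Q *m x + (H *m x - P *m (H *m x)).
    by rewrite -{1}[x]mul1mx e [(Q + _) *m x]mulmxDl -mulmxA mulmxBl mul1mx.
  by rewrite {1}xE mulmxDr mulmxA powQ mulmxBr exprSr -mulmxE -[in RHS]mulmxA.
by rewrite [- _ + _]addrCA addKr addrCA.
Qed.

Lemma cesaro_sum_bounded x : exists K : R, forall s (N : nat),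
  `|\sum_(i < N) (P ^+ i *m x) s 0 - N%:R * (Q *m x) s 0| <= K.
Proof.
have [K hK] := col_bounded (H *m x); exists (K + K) => s N.
have := sum_expmx x N => /matrixP/(_ s 0); rewrite summxE => ->.
rewrite [X in X - _]mxE mulmxnE mulr_natl addrAC subrr add0r [X in `|X|]mxE [X in _ + X]mxE.
apply: le_trans (ler_normB _ _) (lerD (hK s) _).
exact: expmx_norm_le.
Qed.

Lemma cesaro_le x y : (forall (N : nat) s, (P ^+ N *m x) s 0 <= y s 0) -> lev (Q *m x) y.
Proof.
move=> h s; rewrite -subr_le0; have [K hK] := cesaro_sum_bounded x.
apply: (@nat_mul_bounded_le0 _ K) => N; have := hK s N.
rewrite ler_norml => /andP[+ _]; have : \sum_(i < N) (P ^+ i *m x) s 0 <= N%:R * y s 0.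
  rewrite mulr_natl -[X in _ *+ X]card_ord -sumr_const.
  by apply: ler_sum => i _; apply: h.
by rewrite mulrBr; lra.
Qed.

Lemma cesaro_le_super x : lev (P *m x) x -> lev (Q *m x) x.
Proof. by move=> h; apply: cesaro_le => N; apply: expmx_le. Qed.

(** Nonnegativity is [cesaro_le] for minus a unit vector. For the row sums, [1 - Q 1 = (1 - P) H 1]
    is fixed by [P], hence zero. *)
Lemma cesaro_stochastic : stochastic Q.
Proof.
have [PQ e] := PQH; split=> [s t|s].
  have QE : (Q *m - delta_mx t (0 : 'I_1)) s 0 = - Q s t.
    rewrite mulmxN !mxE (bigD1 t) //= mxE !eqxx mulr1 big1 ?addr0 // => u /negbTE ut.
    by rewrite mxE ut mulr0.
  rewrite -oppr_le0 -QE; suff h : lev (Q *m - delta_mx t (0 : 'I_1)) 0.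
    by have := h s; rewrite [X in _ <= X]mxE.
  apply: cesaro_le => N u; rewrite mulmxN !mxE oppr_le0.
  apply: sumr_ge0 => v _; apply: mulr_ge0; last by rewrite mxE; case: (_ && _).
  elim: N u v {QE} => [|N IH] u v; first by rewrite expr0 mxE; case: (_ == _).
  rewrite exprS -mulmxE mxE; apply: sumr_ge0 => w _; apply: mulr_ge0 => //.
  exact: Ps.1.
have QE : Q *m const_mx 1 = const_mx 1 :> 'cV_n.
  apply/eqP; rewrite eq_sym -subr_eq0; apply/eqP.
  apply: (@sub1mx_fix_eq0 P (H *m const_mx 1)) => //.
    by rewrite -{1}[const_mx 1]mul1mx {1}e [(Q + _) *m _]mulmxDl addrAC subrr add0r mulmxA.
  by rewrite mulmxBr mulmx_const // mulmxA PQ.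
have /matrixP/(_ s 0) := QE; rewrite !mxE => <-.
by apply: eq_bigr => t _; rewrite mxE mulr1.
Qed.

Let edge : rel 'I_n := fun s t => 0 < P s t.

Lemma cesaro_step t u v : 0 < Q t u -> edge u v -> 0 < Q t v.
Proof.
move=> Qu Pv; rewrite -cesaro_mulmx_fix mxE (bigD1 u) //=.
apply: ltr_wpDr; last by apply: mulr_gt0.
apply: sumr_ge0 => w _; apply: mulr_ge0; first exact: cesaro_stochastic.1.
exact: Ps.1.
Qed.

Lemma connect_rcons_ind (T : finType) (e : rel T) (S : T -> Prop) a :
  S a -> (forall b c, connect e a b -> S b -> e b c -> S c) ->
  forall b, connect e a b -> S b.
Proof.
move=> Sa Sstep b /connectP[q]; elim/last_ind: q b => [|q c IH] b /=; first by move=> _ ->.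
rewrite rcons_path last_rcons => /andP[qp ec] ->; apply: Sstep ec.
  by apply/connectP; exists q.
exact: IH.
Qed.

Lemma cesaro_connect t u v : 0 < Q t u -> connect edge u v -> 0 < Q t v.
Proof.
move=> Qu; apply: (connect_rcons_ind (S := fun v => 0 < Q t v)) => //.
by move=> b c _; apply: cesaro_step.
Qed.

(* Under the invariant distribution [Q t], no mass enters the closed set of the
   states that do not lead back to [u]. *)
Lemma cesaro_recurrent t u v : 0 < Q t u -> connect edge u v -> connect edge v u.
Proof.
move=> Qu; apply: (connect_rcons_ind (S := fun v => connect edge v u)) => //.
move=> b c ub bu bc; apply: contraT => cu.
pose z : 'cV[R]_n := \col_w (~~ connect edge w u)%:R.
have z_le : lev z (P *m z).
  move=> w; rewrite mxE; have [wu|wu] := boolP (connect edge w u) => /=.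
    rewrite mxE; apply: sumr_ge0 => w' _; rewrite mxE; apply: mulr_ge0 => //.
    exact: Ps.1.
  rewrite mxE -(Ps.2 w); apply: ler_sum => w' _; rewrite mxE.
  have := Ps.1 w w'; rewrite le_eqVlt => /predU1P[<-|ww']; first by rewrite mul0r.
  suff -> : ~~ connect edge w' u by rewrite mulr1.
  by apply: contra wu; apply: connect_trans (connect1 _).
(* The terms of this sum are nonnegative, so [P z = z] at [b], where [z] is 0; but the edge from [b]
   to [c] makes [P z] positive there. *)
have : (Q *m (P *m z - z)) t 0 = 0.
  by rewrite mulmxBr mulmxA cesaro_mulmx_fix subrr mxE.
have y0 w : 0 <= Q t w * (P *m z - z) w 0.
  apply: mulr_ge0; first exact: cesaro_stochastic.1.
  by rewrite [X in _ <= X]mxE [X in _ + X]mxE subr_ge0.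
rewrite mxE => /eqP; rewrite psumr_eq0 // => /allP/(_ b (mem_index_enum _)) /=.
rewrite mulf_eq0 (gt_eqF (cesaro_connect Qu ub)) /= => /eqP.
rewrite [X in X = _]mxE [X in _ + X]mxE [X in _ - X]mxE bu subr0 mxE => h.
suff : 0 < \sum_j P b j * z j 0 by rewrite h ltxx.
rewrite (bigD1 c) //= mxE cu mulr1; apply: ltr_wpDr => //.
by apply: sumr_ge0 => w _; rewrite mxE; apply: mulr_ge0 => //; apply: Ps.1.
Qed.

(** The indicator [z] of the states unreachable from [s] satisfies [P z <= z], so [Q z] vanishes at
    [s]. *)
Lemma cesaro_support_connect s v : 0 < Q s v -> connect edge s v.
Proof.
move=> Qv; apply: contraT => sv.
pose z : 'cV[R]_n := \col_w (~~ connect edge s w)%:R.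
have z_le : lev (P *m z) z.
  move=> w; rewrite [X in _ <= X]mxE; have [sw|sw] := boolP (connect edge s w) => /=.
    rewrite mxE big1 // => w' _; rewrite mxE.
    have := Ps.1 w w'; rewrite le_eqVlt => /predU1P[<-|ww']; first by rewrite mul0r.
    by rewrite (connect_trans sw (connect1 ww')) mulr0.
  rewrite mxE -(Ps.2 w); apply: ler_sum => w' _; rewrite mxE.
  by case: (~~ _); rewrite ?mulr1 ?mulr0 //; apply: Ps.1.
have := cesaro_le_super z_le s; rewrite [X in _ <= X]mxE connect0 /= leNgt.
rewrite mxE (bigD1 v) //= mxE sv mulr1 ltr_wpDr //.
apply: sumr_ge0 => w _; rewrite mxE; apply: mulr_ge0 => //; exact: cesaro_stochastic.1.
Qed.

(** [Q] kills [P h - h], so a candidate gain [g] and bias [h] are compared with the true gain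
    through their one-step error. *)
Lemma gain_decomp r g h :
  Q *m r = Q *m g + Q *m (r + P *m h - h - g).
Proof.
rewrite -mulmxDr addrCA subrr addr0 !mulmxDr mulmxN mulmxA cesaro_mulmx_fix.
by rewrite addrK.
Qed.

(* States where [P *m g] drops strictly below [g] are transient, so the
   condition on [h] only matters where [P *m g] agrees with [g]. *)
Lemma gain_le r g h : lev (P *m g) g ->
  (forall s, (P *m g) s 0 = g s 0 -> r s 0 + (P *m h) s 0 <= g s 0 + h s 0) ->
  lev (Q *m r) (Q *m g) /\ lev (Q *m g) g.
Proof.
move=> Pg rh; split; last exact: cesaro_le_super.
have Q0 := cesaro_stochastic.1.
have d0 t w : 0 <= Q t w * (g - P *m g) w 0.
  by apply: mulr_ge0 => //; rewrite [X in _ <= X]mxE [X in _ + X]mxE subr_ge0.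
move=> t; rewrite (gain_decomp r g h) [X in X <= _]mxE gerDl mxE.
apply: sumr_le0 => w _; have := Q0 t w; rewrite le_eqVlt => /predU1P[<-|Qw].
  by rewrite mul0r.
rewrite pmulr_rle0 //.
(* A sum of nonnegative terms equal to zero: [P g = g] wherever [Q t] has mass. *)
have /eqP : (Q *m (g - P *m g)) t 0 = 0.
  by rewrite mulmxBr mulmxA cesaro_mulmx_fix subrr mxE.
rewrite mxE psumr_eq0 // => /allP/(_ w (mem_index_enum _)) /=.
rewrite mulf_eq0 (gt_eqF Qw) /= => /eqP; rewrite [X in X = _]mxE [X in _ + X]mxE.
move=> /eqP; rewrite subr_eq0 eq_sym => /eqP /rh.
have -> : (r + P *m h - h - g) w 0 = r w 0 + (P *m h) w 0 - h w 0 - g w 0.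
  by rewrite !mxE.
by lra.
Qed.

Lemma gain_ge r g h : lev g (P *m g) ->
  (forall s, (P *m g) s 0 = g s 0 -> g s 0 + h s 0 <= r s 0 + (P *m h) s 0) ->
  lev (Q *m g) (Q *m r) /\ lev (P *m g) (Q *m g).
Proof.
have oppE x s : (- x) s 0 = - x s 0 by rewrite mxE.
move=> Pg rh; have [||h1 h2] := @gain_le (- r) (- g) (- h).
- by move=> s; rewrite mulmxN !oppE lerN2.
- move=> s; rewrite !mulmxN !oppE => /oppr_inj /rh; lra.
split=> s.
  by have := h1 s; rewrite !mulmxN !oppE lerN2.
(* Negating [gain_le] gives [g <= Q g]; applying [P] sharpens it to [P g <= P Q g = Q g]. *)
have [PQ _] := PQH; rewrite -PQ -mulmxA; apply: mulmx_le => // t.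
by have := h2 t; rewrite !mulmxN !oppE lerN2.
Qed.

End Cesaro.
End Markov.

(** * Markov decision processes *)

Section Bridge.
Variables (R : realType) (n k : nat) (M : MDP R n k) (c : criterion R).
Implicit Types (pi sg : policy n k).

Definition value_le : rel (policy n k) := fun pi sg => dominates M c sg pi.

Lemma strictly_dominatesE pi sg : strictly_dominates M c sg pi = slt value_le pi sg.
Proof.
rewrite /strictly_dominates /slt /value_le; congr andb.
rewrite {1}/dominates negb_forall.
by apply: eq_existsb => s; rewrite ltNge.
Qed.

Lemma switch1 pi s a : switch pi [set (s, a)]%SET = upd pi s a.
Proof.
apply/ffunP => t; rewrite !ffunE; case: pickP => [b|h].
  by rewrite inE => /eqP[-> ->]; rewrite eqxx.
by have := h a; rewrite inE xpair_eqE eqxx andbT => ->.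
Qed.

Lemma improvement_setE pi s a :
  ((s, a) \in improvement_set M c pi) = slt value_le pi (upd pi s a).
Proof. by rewrite inE switch1 strictly_dominatesE. Qed.

Lemma improvement_statesE pi :
  improvement_states M c pi = improving_states value_le pi.
Proof.
apply/setP => s; rewrite inE; apply/imsetP/existsP.
  by move=> [[t a]]; rewrite improvement_setE => h /= ->; exists a.
by move=> [a h]; exists (s, a) => //; rewrite improvement_setE.
Qed.

Lemma greedy_stepP pi sg : greedy_step M c pi sg -> greedy value_le pi sg.
Proof.
move=> /andP[/set0Pn[u0 u0T] /existsP[U /and4P[wd UT /eqP cU /eqP ->]]].
(* A well-defined [U] projects injectively to states, so its cardinality makes it cover every
   improvement state. *)
have fstU : [set u.1 | u in U]%SET = improvement_states M c pi.
  apply/eqP; rewrite eqEcard imsetS //= -cU card_in_imset // => -[s a] [t b] ha hb /= e.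
  subst t; congr pair; have /forallP/(_ s) /card_le1_eqP := wd.
  by apply; rewrite inE.
have noself s a : (s, a) \in improvement_set M c pi -> a != pi s.
  rewrite improvement_setE; apply: contraTneq => ->.
  by rewrite upd_self slt_irr.
have swP s : if s \in improvement_states M c pi
    then (s, switch pi U s) \in improvement_set M c pi else switch pi U s == pi s.
  rewrite ffunE; case: pickP => [a ha|h].
    have aT : (s, a) \in improvement_set M c pi by apply: (fintype.subsetP UT).
    by have -> : s \in improvement_states M c pi by apply/imsetP; exists (s, a).
  case: ifP => //; rewrite -fstU => /imsetP[[t a] hU /= e].
  by have := h a; rewrite e hU.
have dE : diffs pi (switch pi U) = improvement_states M c pi.
  apply/setP => s; rewrite inE; have := swP s; case: ifP => _.
    by move/noself; rewrite eq_sym.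
  by move=> /eqP ->; rewrite eqxx.
split.
- rewrite -diffs_eq0 dE; apply/set0Pn; exists u0.1.
  by apply/imsetP; exists u0.
- by rewrite dE improvement_statesE.
- move=> s hs; have := swP s; rewrite -dE inE hs.
  by rewrite improvement_setE.
Qed.

Lemma GPI_run_bound (dflt : 'I_k) W pi0 run D :
  improvement_order value_le W -> (0 < D)%N -> GPI_run M c pi0 run ->
  (size run <= k ^ n %/ D + #|small_support n dflt D|)%N.
Proof.
move=> ord D0 /(pathP pi0) h.
apply: (greedy_run_bound (p := fun i => nth pi0 (pi0 :: run) i) dflt ord) => // i hi.
exact/greedy_stepP/h.
Qed.

Definition lookahead (x : 'cV[R]_n) s a : R := \sum_t trans M s a t * x t 0.

Lemma trans_mx_mulE pi x s : (trans_mx M pi *m x) s 0 = lookahead x s (pi s).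
Proof. by rewrite mxE; apply: eq_bigr => t _; rewrite mxE. Qed.

Lemma trans_mx_stochastic pi : stochastic (trans_mx M pi).
Proof.
split=> [s t|s]; first by rewrite mxE trans_ge0.
by under eq_bigr do rewrite mxE; apply: trans_sum1.
Qed.

Lemma reward_vecE pi s : reward_vec M pi s 0 = reward M s (pi s).
Proof. by rewrite mxE. Qed.

End Bridge.

(** * The discounted criterion *)

Section Discounted.
Variables (R : realType) (n k : nat) (M : MDP R n k).
Variables (gamma : R) (hg : 0 <= gamma < 1).
Implicit Types (pi sg : policy n k).
Let c := Discounted hg.

(** Minimum principle: at a minimizer [s0], [w s0 >= gamma * (P w) s0 >= gamma * w s0], and
    [gamma < 1]. *)
Lemma discount_ge0 (P : 'M[R]_n) (w : 'cV_n) : stochastic P ->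
  (forall s, gamma * (P *m w) s 0 <= w s 0) -> forall s, 0 <= w s 0.
Proof.
move=> Ps h s; have /andP[g0 g1] := hg.
have [s0 _ hmin] := @arg_minP _ _ _ s xpredT (fun t => w t 0) isT.
suff : 0 <= w s0 0 by move/le_trans; apply; apply: hmin.
have Pw : w s0 0 <= (P *m w) s0 0.
  rewrite mxE -[X in X <= _]mul1r -(Ps.2 s0) mulr_suml.
  apply: ler_sum => t _; apply: ler_wpM2l; [exact: Ps.1 | exact: hmin].
have h0 := h s0; have h1 := ler_wpM2l g0 Pw.
rewrite leNgt; apply/negP => wneg.
have : 0 < (1 - gamma) * - w s0 0 by apply: mulr_gt0; rewrite ?subr_gt0 ?oppr_gt0.
by lra.
Qed.

Lemma discount_fixpoint (P : 'M[R]_n) (r : 'cV_n) : stochastic P ->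
  exists v : 'cV_n, v = r + gamma *: (P *m v).
Proof.
move=> Ps; set A := 1%:M - gamma *: P.
have Ainj (x : 'cV_n) : A *m x = 0 -> x = 0.
  rewrite mulmxBl mul1mx => /eqP; rewrite subr_eq0 -scalemxAl => /eqP xE.
  have pos : forall s, 0 <= x s 0.
    by apply: (@discount_ge0 P) => // s; rewrite {2}xE [X in _ <= X]mxE.
  have neg : forall s, 0 <= (- x) s 0.
    apply: (@discount_ge0 P) => // s; rewrite mulmxN [X in _ <= X]mxE {2}xE.
    by rewrite [X in _ * X]mxE [X in _ <= - X]mxE mulrN.
  apply/matrixP => s j; rewrite ord1 [RHS]mxE; apply/eqP; rewrite eq_le pos.
  by have := neg s; rewrite mxE oppr_ge0 => ->.
have Au : A \in unitmx.
  rewrite -unitmx_tr -row_free_unit -kermx_eq0; apply/rowV0P => u /sub_kermxP h.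
  apply: trmx_inj; rewrite trmx0; apply: Ainj.
  by rewrite -[A]trmxK -trmx_mul h trmx0.
exists (invmx A *m r); apply/eqP; rewrite -subr_eq scalemxAl.
by rewrite -{1}[invmx A *m r]mul1mx -mulmxBl mulmxA mulmxV // mul1mx.
Qed.

(** The partial sums telescope to [v - gamma ^+ N * P ^+ N v], whose second term tends to 0. *)
Lemma value_discounted pi (v : 'cV_n) s :
  v = reward_vec M pi + gamma *: (trans_mx M pi *m v) -> value M c pi s = v s 0.
Proof.
move=> vE; have /andP[g0 g1] := hg; have Ps := trans_mx_stochastic M pi.
have [K hK] := col_bounded v; set P := trans_mx M pi in vE Ps *.
have sumE N : series (fun i => gamma ^+ i * step_reward M pi s i) N =
    v s 0 - gamma ^+ N * (P ^+ N *m v) s 0.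
  rewrite /series /= big_mkord; elim: N => [|N IH].
    by rewrite big_ord0 !expr0 mul1mx mul1r subrr.
  rewrite big_ord_recr /= IH /step_reward -/P.
  have -> : (P ^+ N *m reward_vec M pi) s 0 =
      (P ^+ N *m v) s 0 - gamma * (P ^+ N.+1 *m v) s 0.
    rewrite {1}vE mulmxDr -scalemxAr exprSr -mulmxE -mulmxA.
    by rewrite [X in X - _]mxE [X in _ + X - _]mxE addrK.
  by rewrite [gamma ^+ N.+1]exprS; ring.
apply: cvg_lim => //; rewrite (_ : series _ =
    fun N => v s 0 - gamma ^+ N * (P ^+ N *m v) s 0); last exact/funext.
rewrite -[X in (_ --> X)%classic]subr0; apply: cvgB; first exact: cvg_cst.
apply/cvgr0Pnorm_le => e e0.
have K0 : 0 <= K by apply: le_trans (hK s).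
have := @cvg_expr R gamma; rewrite ger0_norm // => /(_ g1) /cvgr0Pnorm_le.
(* [K + 1] instead of [K] avoids a zero denominator. *)
move=> /(_ (e / (K + 1))); rewrite divr_gt0 ?ltr_wpDl // => /(_ isT).
apply: filterS => N.
rewrite normrM ler_pdivlMr ?ltr_wpDl // => h; apply: le_trans h.
apply: ler_wpM2l => //; apply: le_trans (expmx_norm_le N Ps hK s) _; lra.
Qed.

Lemma discounted_order : exists W, improvement_order (value_le M c) W.
Proof.
have /choice[v vE] : forall pi, exists v : 'cV_n,
    v = reward_vec M pi + gamma *: (trans_mx M pi *m v).
  by move=> pi; apply: discount_fixpoint; apply: trans_mx_stochastic.
have vEs pi s : v pi s 0 = reward M s (pi s) + gamma * lookahead M (v pi) s (pi s).
  by rewrite {1}vE mxE reward_vecE [X in _ + X]mxE trans_mx_mulE.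
have leP pi sg : reflect (forall s, v pi s 0 <= v sg s 0) (value_le M c pi sg).
  by apply: (iffP forallP) => h s; have := h s; rewrite !(value_discounted _ (vE _)).
have /andP[g0 g1] := hg.
have lookB x y s a : lookahead M (x - y) s a = lookahead M x s a - lookahead M y s a.
  by rewrite /lookahead -sumrB; apply: eq_bigr => t _; rewrite !mxE mulrBr.
pose W pi s a := v pi s 0 < reward M s a + gamma * lookahead M (v pi) s a.
(* The difference of the two value vectors exceeds [gamma] times its image under the chain of [sg]
   by the one-step error, so the minimum principle applies. *)
have cmp_ge pi sg : (forall s, v pi s 0 <= reward M s (sg s)
      + gamma * lookahead M (v pi) s (sg s)) -> value_le M c pi sg.
  move=> h; apply/leP => s; rewrite -subr_ge0.
  have := @discount_ge0 _ (v sg - v pi) (trans_mx_stochastic M sg) _ s.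
  rewrite 2!mxE; apply=> t; rewrite trans_mx_mulE lookB !mxE (vEs sg t).
  by have := h t; lra.
have cmp_le pi sg : (forall s, ~~ W pi s (sg s)) -> value_le M c sg pi.
  move=> h; apply/leP => s; rewrite -subr_ge0.
  have := @discount_ge0 _ (v pi - v sg) (trans_mx_stochastic M sg) _ s.
  rewrite 2!mxE; apply=> t; rewrite trans_mx_mulE lookB !mxE (vEs sg t).
  by have := h t; rewrite -leNgt; lra.
have Wself pi s : W pi s (pi s) = false by rewrite /W -vEs lt_irreflexive.
exists W; split=> //.
- by move=> pi; apply/leP.
- move=> sg pi rho /leP h1 /leP h2; apply/leP => s; exact: le_trans (h1 s) (h2 s).
- move=> pi s a h; apply: cmp_ge => t; rewrite ffunE; case: eqP => [->|_].
    exact: ltW.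
  by rewrite -vEs.
- move=> pi sg neq h.
  have hW s : pi s != sg s -> W pi s (sg s).
    move=> /h /andP[_]; apply: contraNT => hn; apply: cmp_le => t.
    by rewrite ffunE; case: eqP => [->//|_]; rewrite Wself.
  have le1 : value_le M c pi sg.
    apply: cmp_ge => s; have [<-|/hW/ltW//] := eqVneq (pi s) (sg s).
    by rewrite -vEs.
  rewrite /slt le1; apply/leP => le2.
  have : diffs pi sg != finset.set0 by rewrite diffs_eq0.
  move=> /set0Pn[s]; rewrite inE => /hW; rewrite /W ltNge => /negP; apply.
  (* At a switched state the one-step value strictly exceeds [v pi], while [le1] bounds it by
     [v sg], hence by [v pi]. *)
  apply: le_trans (le2 s); rewrite (vEs sg s) lerD2l; apply: ler_wpM2l => //.
  apply: ler_sum => t _; apply: ler_wpM2l; first exact: trans_ge0.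
  by move/leP: le1; apply.
Qed.

End Discounted.

(** * The average criterion *)

Section Average.
Variables (R : realType) (n k : nat) (M : MDP R n k).
Implicit Types (pi sg : policy n k).
Let c := @Average R.

(** The total reward stays within a constant of [N] times the gain, so the averages converge and the
    limsup is a limit. *)
Lemma value_average pi (Q H : 'M[R]_n) s : cesaro_pair (trans_mx M pi) Q H ->
  value M c pi s = (Q *m reward_vec M pi) s 0.
Proof.
move=> PQH; have Ps := trans_mx_stochastic M pi.
have [K hK] := cesaro_sum_bounded Ps PQH (reward_vec M pi).
set g := (Q *m _) s 0.
pose a : nat -> R := fun N => N%:R^-1 * \sum_(i < N) step_reward M pi s i.
suff /cvg_limn_inf_sup[_ //] : (a N @[N --> \oo] --> g)%classic.
apply/cvgrPdist_le => e e0.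
exists (Num.truncn (K / e)).+1 => // N /= hN.
have N0 : 0 < N%:R :> R by rewrite ltr0n; apply: leq_trans hN.
have -> : g - N%:R^-1 * \sum_(i < N) step_reward M pi s i =
    - (N%:R^-1 * (\sum_(i < N) step_reward M pi s i - N%:R * g)).
  by rewrite mulrBr mulKf ?gt_eqF // opprB.
rewrite normrN normrM gtr0_norm ?invr_gt0 // mulrC ler_pdivrMr //.
apply: le_trans (hK s N) _; rewrite -ler_pdivrMl // mulrC.
apply: ltW; apply: lt_le_trans (truncnS_gt _) _.
by rewrite ler_nat.
Qed.

Let edge pi : rel 'I_n := fun s t => 0 < trans_mx M pi s t.

Lemma edge_row pi sg s t : pi s = sg s -> edge pi s t = edge sg s t.
Proof. by move=> e; rewrite /edge !mxE e. Qed.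

(* From a switched state [u0], the chain of [sg] stays among states reachable
   from a last visited switched state [u] along rows shared by [sg] and
   [upd pi u (sg u)]; recurrence of [u] in the latter chain leads back to a
   switched state. *)
Lemma switch_recurrent pi sg (Q H : policy n k -> 'M[R]_n) :
  (forall rho, cesaro_pair (trans_mx M rho) (Q rho) (H rho)) -> pi != sg ->
  (forall u, pi u != sg u -> exists t, 0 < Q (upd pi u (sg u)) t u) ->
  exists2 u, pi u != sg u & exists t, 0 < Q sg t u.
Proof.
move=> PQH neq rec; have Ps := trans_mx_stochastic M.
have : diffs pi sg != finset.set0 by rewrite diffs_eq0.
move=> /set0Pn[u0]; rewrite inE => u0D.
pose single u := upd pi u (sg u).
have edge_at u t : edge (single u) u t = edge sg u t.
  by apply: edge_row; rewrite ffunE eqxx.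
have edge_off u s t : ~~ (pi s != sg s) -> edge (single u) s t = edge sg s t.
  by rewrite negbK => /eqP e; apply: edge_row; rewrite ffunE; case: eqP => [->|].
have reach x : connect (edge sg) u0 x ->
    exists2 u, pi u != sg u & connect (edge (single u)) u x.
  move: x; apply: connect_rcons_ind; first by exists u0 => //; apply: connect0.
  move=> x y _ [u uD ux] xy; have [xD|xD] := boolP (pi x != sg x).
    by exists x => //; apply: connect1; rewrite edge_at.
  by exists u => //; apply: connect_trans ux (connect1 _); rewrite edge_off.
have back u x : pi u != sg u -> connect (edge (single u)) x u ->
    exists2 u', pi u' != sg u' & connect (edge sg) x u'.
  move=> uD /connectP[q]; elim: q x => [|y q IH] x /=.
    by move=> _ e; exists u => //; rewrite e; apply: connect0.
  move=> /andP[xy yq] ql; have [xD|xD] := boolP (pi x != sg x).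
    by exists x => //; apply: connect0.
  have [u' u'D yu'] := IH y yq ql; exists u' => //.
  by apply: connect_trans (connect1 _) yu'; rewrite -(edge_off u).
have [x Qx] : exists x, 0 < Q sg u0 x.
  have [Q0 Q1] := cesaro_stochastic (Ps sg) (PQH sg).
  have /existsP[x hx] : [exists x, 0 < Q sg u0 x]; last by exists x.
  apply: contraT; rewrite negb_exists => /forallP h.
  suff : (1 : R) <= 0 by rewrite ler10.
  by rewrite -(Q1 u0); apply: sumr_le0 => x _; rewrite leNgt.
have [u uD ux] := reach x (cesaro_support_connect (Ps sg) (PQH sg) Qx).
have [t Qt] := rec u uD.
have xu := cesaro_recurrent (Ps _) (PQH _) Qt ux.
have [u' u'D xu'] := back u x uD xu.
by exists u' => //; exists u0; apply: cesaro_connect (Ps sg) (PQH sg) _ _ _ Qx xu'.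
Qed.

Lemma average_order : exists W, improvement_order (value_le M c) W.
Proof.
have Ps := trans_mx_stochastic M.
have /choice[QH PQH'] : forall pi, exists QH : 'M[R]_n * 'M[R]_n,
    cesaro_pair (trans_mx M pi) QH.1 QH.2.
  by move=> pi; have [Q [H h]] := cesaro_pair_exists (Ps pi); exists (Q, H).
pose Q pi := (QH pi).1; pose H pi := (QH pi).2.
have PQH pi : cesaro_pair (trans_mx M pi) (Q pi) (H pi) by apply: PQH'.
pose g pi := Q pi *m reward_vec M pi; pose h pi := H pi *m reward_vec M pi.
have PgE pi : trans_mx M pi *m g pi = g pi by rewrite mulmxA (PQH pi).1.
have QgE pi : Q pi *m g pi = g pi.
  rewrite /g mulmxA; congr (_ *m _).
  apply/eqP; rewrite eq_sym -subr_eq0; apply/eqP.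
  apply: (@sub1mx_fix_mx_eq0 _ _ (trans_mx M pi) (H pi *m Q pi)) => //.
    have := PQH pi => -[_ e].
    by rewrite -{1}[Q pi]mul1mx {1}e [(Q pi + _) *m _]mulmxDl addrAC subrr add0r mulmxA.
  by rewrite mulmxBr mulmxA (PQH pi).1.
have bias pi s : g pi s 0 + h pi s 0 =
    reward M s (pi s) + lookahead M (h pi) s (pi s).
  have : reward_vec M pi = g pi + (h pi - trans_mx M pi *m h pi).
    rewrite -{1}[reward_vec M pi]mul1mx (PQH pi).2 [(Q pi + _) *m _]mulmxDl -/(g pi).
    by rewrite -mulmxA -/(h pi) mulmxBl mul1mx.
  move=> /matrixP/(_ s 0); rewrite reward_vecE => ->.
  rewrite -trans_mx_mulE.
  have -> : (g pi + (h pi - trans_mx M pi *m h pi)) s 0 =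
    g pi s 0 + (h pi s 0 - (trans_mx M pi *m h pi) s 0) by rewrite !mxE.
  by ring.
have leP pi sg : reflect (lev (g pi) (g sg)) (value_le M c pi sg).
  by apply: (iffP forallP) => hs s; have := hs s; rewrite !(value_average _ (PQH _)).
(* [A] is the expected gain after one step, [D] the one-step reward plus expected bias; [W] compares
   them lexicographically. *)
pose A pi s a := lookahead M (g pi) s a.
pose D pi s a := reward M s a + lookahead M (h pi) s a.
pose W pi s a := (g pi s 0 < A pi s a) ||
  ((A pi s a == g pi s 0) && (g pi s 0 + h pi s 0 < D pi s a)).
have Aself pi s : A pi s (pi s) = g pi s 0 by rewrite /A -trans_mx_mulE PgE.
have Dself pi s : D pi s (pi s) = g pi s 0 + h pi s 0 by rewrite bias.
have Wself pi s : W pi s (pi s) = false.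
  by rewrite /W Aself Dself !lt_irreflexive andbF.
have cmp_le pi sg : (forall s, ~~ W pi s (sg s)) -> value_le M c sg pi.
  move=> hW; have [||h1 h2] := gain_le (Ps sg) (PQH sg)
      (r := reward_vec M sg) (g := g pi) (h := h pi).
  - by move=> s; rewrite trans_mx_mulE; have := hW s; rewrite negb_or -leNgt => /andP[].
  - move=> s; rewrite trans_mx_mulE => e; have := hW s.
    rewrite /W /A e lt_irreflexive eqxx /= -leNgt.
    by rewrite reward_vecE trans_mx_mulE.
  - by apply/leP => s; apply: le_trans (h1 s) (h2 s).
have cmp_ge pi sg : (forall s, pi s != sg s -> W pi s (sg s)) ->
    [/\ lev (g pi) (trans_mx M sg *m g pi),
        lev (trans_mx M sg *m g pi) (Q sg *m g pi) & lev (Q sg *m g pi) (g sg)].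
  move=> hW; have weak s : g pi s 0 < A pi s (sg s) \/
      (A pi s (sg s) = g pi s 0 /\ g pi s 0 + h pi s 0 <= D pi s (sg s)).
    have [<-|/hW /orP[->|/andP[/eqP e /ltW l]]] := eqVneq (pi s) (sg s).
    - by right; rewrite Aself Dself.
    - by left.
    - by right.
  have l1 : lev (g pi) (trans_mx M sg *m g pi).
    move=> s; rewrite trans_mx_mulE.
    by case: (weak s) => [/ltW //|[]]; rewrite /A => ->.
  have [|h1 h2] := gain_ge (Ps sg) (PQH sg)
      (r := reward_vec M sg) (h := h pi) l1; last by split.
  move=> s; rewrite !trans_mx_mulE reward_vecE => e.
  by case: (weak s) => [|[]//]; rewrite /A e lt_irreflexive.
exists W; split=> //.
- by move=> pi; apply/leP => s.
- move=> sg pi rho /leP h1 /leP h2; apply/leP => s; exact: le_trans (h1 s) (h2 s).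
- move=> pi s a ha; have [|h1 h2 h3] := cmp_ge pi (upd pi s a).
    by move=> t; rewrite ffunE; case: (t =P s) => [->//|_]; rewrite eqxx.
  by apply/leP => t; apply: le_trans (h1 t) (le_trans (h2 t) (h3 t)).
move=> pi sg neq imp.
have hW s : pi s != sg s -> W pi s (sg s).
  move=> /imp /andP[_]; apply: contraNT => hn; apply: cmp_le => t.
  by rewrite ffunE; case: eqP => [->//|_]; rewrite Wself.
have [h1 h2 h3] := cmp_ge pi sg hW.
have le1 : value_le M c pi sg.
  by apply/leP => t; apply: le_trans (h1 t) (le_trans (h2 t) (h3 t)).
rewrite /slt le1; apply/leP => le2.
(* If [sg] had no larger gain, the chain of inequalities in [cmp_ge] would collapse, so every switch
   would preserve the expected gain and improve only the bias. *)
have Peq : trans_mx M sg *m g pi = g pi.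
  apply/matrixP => s j; rewrite ord1; apply/eqP; rewrite eq_le h1 andbT.
  exact: le_trans (h2 s) (le_trans (h3 s) (le2 s)).
have Qeq : Q sg *m g pi = g pi.
  apply/matrixP => s j; rewrite ord1; apply/eqP; rewrite eq_le (le_trans (h3 s) (le2 s)).
  exact: le_trans (h1 s) (h2 s).
have Aeq s : A pi s (sg s) = g pi s 0 by rewrite /A -trans_mx_mulE Peq.
pose y rho := reward_vec M rho + trans_mx M rho *m h pi - h pi - g pi.
have yE rho s : y rho s 0 = D pi s (rho s) - (g pi s 0 + h pi s 0).
  rewrite /D -trans_mx_mulE -(reward_vecE M rho).
  have -> : y rho s 0 = reward_vec M rho s 0 + (trans_mx M rho *m h pi) s 0
    - h pi s 0 - g pi s 0 by rewrite !mxE.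
  by ring.
(* If the limit matrix of the single switch put no mass on [u], the error [y tau], which vanishes
   off [u], would not contribute to the gain, and the switch could not be improving. *)
have rec u : pi u != sg u -> exists t, 0 < Q (upd pi u (sg u)) t u.
  move=> uD; set tau := upd pi u (sg u).
  have Q0 := (cesaro_stochastic (Ps tau) (PQH tau)).1.
  have /existsP[t ht] : [exists t, 0 < Q tau t u]; last by exists t.
  apply: contraT; rewrite negb_exists => /forallP hn.
  have Qu t : Q tau t u = 0 by apply/eqP; rewrite eq_le Q0 andbT leNgt.
  have Pt : trans_mx M tau *m g pi = g pi.
    apply/matrixP => s j; rewrite ord1 trans_mx_mulE -/(A pi s _) ffunE.
    by case: eqP => [->|_]; rewrite ?Aeq ?Aself.
  have Qt : lev (Q tau *m g pi) (g pi).
    by apply: cesaro_le_super (Ps tau) (PQH tau) _ _ => s; rewrite Pt.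
  have /andP[_ /leP []] := imp u uD; rewrite -/tau => t.
  rewrite /g (gain_decomp (Ps tau) (PQH tau) _ (g pi) (h pi)) -/(y tau).
  rewrite mxE [X in _ + X]mxE big1 ?addr0 => [|s _]; first exact: Qt.
  rewrite yE ffunE; case: eqP => [->|_]; first by rewrite Qu mul0r.
  by rewrite Dself subrr mulr0.
(* Some switched state carries mass under [Q sg]; [y sg] is positive there and nowhere negative, so
   the gain rises at [t], a contradiction. *)
have [u uD [t Qtu]] := switch_recurrent PQH neq rec.
have := le2 t; rewrite {1}/g (gain_decomp (Ps sg) (PQH sg) _ (g pi) (h pi)) -/(y sg) Qeq.
rewrite mxE gerDl leNgt mxE (bigD1 u) //= => /negP; apply.
have Wy s : pi s != sg s -> 0 < y sg s 0.
  by move=> /hW; rewrite /W yE subr_gt0 Aeq lt_irreflexive eqxx.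
apply: ltr_wpDr; last by apply: mulr_gt0 => //; apply: Wy.
apply: sumr_ge0 => s _; apply: mulr_ge0.
  exact: (cesaro_stochastic (Ps sg) (PQH sg)).1.
have [e|/Wy/ltW//] := eqVneq (pi s) (sg s).
by rewrite yE -e Dself subrr.
Qed.

End Average.

Lemma improvement_order_exists (R : realType) (n k : nat) (M : MDP R n k)
  (c : criterion R) : exists W, improvement_order (value_le M c) W.
Proof. by case: c => [|gamma hg]; [apply: average_order|apply: discounted_order]. Qed.

(** * Asymptotics *)

Local Open Scope classical_set_scope.
Local Open Scope ring_scope.

Section Asymptotics.
Variables (R : realType) (k : nat) (dflt : 'I_k).

(** The right side is the generating function of support sizes, in which each policy of small
    support contributes at least [t ^+ D]. *)
Lemma card_small_support (n D : nat) (t : R) : 0 < t <= 1 ->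
  #|small_support n dflt D|%:R * t ^+ D <= (1 + k.-1%:R * t) ^+ n.
Proof.
move=> /andP[t0 t1].
have -> : (1 + k.-1%:R * t) ^+ n = \sum_(b : policy n k) t ^+ #|support dflt b|.
  have -> : 1 + k.-1%:R * t = \sum_(a : 'I_k) (if a == dflt then 1 else t).
    rewrite (bigD1 dflt) //= eqxx; congr (_ + _).
    under eq_bigr => a /negbTE -> do [].
    by rewrite sumr_const cardC1 card_ord mulr_natl.
  rewrite -[X in _ ^+ X]card_ord -prodr_const bigA_distr_bigA /=.
  apply: eq_bigr => b _; rewrite (bigID (fun s => b s == dflt)) /= big1.
    rewrite mul1r -prodr_const; apply: eq_big => s; first by rewrite inE.
    by move=> /negbTE ->.
  by move=> s ->.
rewrite mulr_natl -sumr_const [X in _ <= X](bigID (mem (small_support n dflt D))) /=.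
rewrite ler_wpDr //; first by apply: sumr_ge0 => b _; apply/exprn_ge0/ltW.
by apply: ler_sum => b; rewrite inE => h; rewrite ler_wiXn2l // ltW.
Qed.

Hypothesis k2 : (2 <= k)%N.
Let p : R := k.-1%:R / k%:R.

Let kE : k%:R = k.-1%:R + 1 :> R.
Proof. by rewrite natr1 prednK //; lia. Qed.

Let k1 : 1 <= k.-1%:R :> R.
Proof. by rewrite ler1n; lia. Qed.

Let k0 : 0 < k%:R :> R.
Proof. by have := k1; rewrite kE; lra. Qed.

Let pk : p * k%:R = k.-1%:R.
Proof. by rewrite /p divfK // gt_eqF. Qed.

Let p_half : 1 / 2 <= p.
Proof. by have := k1; rewrite /p ler_pdivlMr // kE; lra. Qed.

Let p_lt1 : p < 1.
Proof. by have := k1; rewrite /p ltr_pdivrMr // kE; lra. Qed.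

(* Chernoff bound with tilting parameter [d / 2]. *)
Lemma card_small_support_exp (n D : nat) (d : R) : 0 < d <= 1 ->
  D%:R <= (p - d) * n%:R ->
  #|small_support n dflt D|%:R <= k%:R ^+ n * expR (- (n%:R * (d ^+ 2 / 4))).
Proof.
move=> /andP[d0 d1] hD; have ph := p_half; have pl1 := p_lt1; set y := d / 2; set t := expR (- y).
have y0 : 0 < y by rewrite /y; lra.
(* From [expR y >= 1 + y] and [(1 - y + y^2) (1 + y) = 1 + y^3 >= 1]. *)
have t_le : t <= 1 - y + y ^+ 2.
  rewrite /t expRN -[X in X <= _]mul1r ler_pdivrMr ?expR_gt0 //.
  apply: (@le_trans _ _ ((1 - y + y ^+ 2) * (1 + y))); last first.
    by apply: ler_wpM2l (expR_ge1Dx _); nra.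
  have := exprn_ge0 3 (ltW y0); rewrite !exprS expr0; lra.
have tD : t ^+ D * expR (y * D%:R) = 1.
  by rewrite /t -expRM_natl -expRD mulrN mulrC addNr expR0.
have base : 1 + k.-1%:R * t <= k%:R * expR (- (p * (y - y ^+ 2))).
  have -> : 1 + k.-1%:R * t = k%:R * (1 - p * (1 - t)).
    by rewrite mulrBr mulr1 mulrA [k%:R * p]mulrC pk kE; ring.
  apply: ler_wpM2l; first exact: ler0n.
  apply: le_trans (expR_ge1Dx _); rewrite lerD2l lerN2.
  by apply: ler_wpM2l; lra.
have h : #|small_support n dflt D|%:R * t ^+ D <= (1 + k.-1%:R * t) ^+ n.
  by apply: card_small_support; rewrite expR_gt0 /= /t -expR0 ler_expR; lra.
have -> : #|small_support n dflt D|%:R =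
    #|small_support n dflt D|%:R * t ^+ D * expR (y * D%:R) :> R.
  by rewrite -mulrA tD mulr1.
apply: (@le_trans _ _ ((k%:R * expR (- (p * (y - y ^+ 2)))) ^+ n * expR (y * D%:R))).
  rewrite ler_pM2r ?expR_gt0 //; apply: le_trans h _; apply: lerXn2r base; rewrite nnegrE.
    by rewrite addr_ge0 // mulr_ge0 // expR_ge0.
  by rewrite mulr_ge0 // expR_ge0.
rewrite exprMn -mulrA ler_pM2l ?exprn_gt0 //.
rewrite -expRM_natl -expRD ler_expR.
(* With [d = 2 y], the exponent per state is at most [y (p - d) - p (y - y^2) = p y^2 - 2 y^2 <= -
   y^2 = - d^2 / 4]. *)
have := ler_wpM2l (ltW y0) hD; have n0 : 0 <= n%:R :> R by [].
have : 0 <= n%:R * ((1 - p) * y ^+ 2) by rewrite !mulr_ge0 ?sqr_ge0 //; lra.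
rewrite (_ : d = 2 * y); last by rewrite /y; field.
by rewrite !exprS expr0; lra.
Qed.

Definition greedy_bound (n D : nat) : nat := (k ^ n %/ D + #|small_support n dflt D|)%N.

Lemma greedy_bound_asympt (e : R) : 0 < e -> exists N : nat, forall n, (N <= n)%N ->
  exists2 D, (0 < D <= n)%N &
    (greedy_bound n D)%:R <= (k%:R / (k%:R - 1) + e) * (k%:R ^+ n / n%:R).
Proof.
(* [d <= 1/8] keeps [p - 2 d >= 1/4], and [d <= e/32] keeps [1 / (p - 2 d) <= 1 / p + e / 2], where
   [1 / p = k / (k - 1)]. *)
move=> e0; pose d := Num.min (1 / 8) (e / 32).
have d0 : 0 < d by rewrite lt_min; apply/andP; split; lra.
have d8 : d <= 1 / 8 by rewrite ge_min lexx.
have de : d <= e / 32 by rewrite ge_min lexx orbT.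
pose a := d ^+ 2 / 4; have a0 : 0 < a by rewrite divr_gt0 // exprn_gt0.
(* The first bound gives [n d >= 1], which absorbs the rounding in [D]; the second lets the
   exponential decay beat [1 / n], through [expR x >= x^2 / 4]. *)
pose N := maxn (Num.truncn (d^-1)).+1 (Num.truncn (8 / (e * a ^+ 2))).+1.
exists N => n; rewrite geq_max => /andP[hn1 hn2].
have nd : d^-1 <= n%:R.
  by apply: ltW; apply: lt_le_trans (truncnS_gt _) _; rewrite ler_nat.
have na : 8 / (e * a ^+ 2) <= n%:R.
  by apply: ltW; apply: lt_le_trans (truncnS_gt _) _; rewrite ler_nat.
have n0 : 0 < n%:R :> R by apply: lt_le_trans nd; rewrite invr_gt0.
have nd1 : 1 <= n%:R * d by rewrite -ler_pdivrMr // div1r.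
set D := Num.truncn ((p - d) * n%:R).
have := p_half; have := p_lt1; have := k1 => k1' pl1 ph.
have pos : 0 <= (p - d) * n%:R by rewrite mulr_ge0 // ?ltW //; lra.
have Dle : D%:R <= (p - d) * n%:R by rewrite truncn_le.
have Dge : (p - 2 * d) * n%:R <= D%:R.
  have := truncnS_gt ((p - d) * n%:R); rewrite -/D -natr1; lra.
have q0 : 1 / 4 <= p - 2 * d by lra.
have D0 : 0 < D%:R :> R by apply: lt_le_trans Dge; rewrite mulr_gt0 //; lra.
exists D.
  rewrite -(ltr0n R) D0 /= -(ler_nat R); apply: le_trans Dle _.
  by rewrite -[X in _ <= X]mul1r ler_wpM2r // ?ltW //; lra.
have kn0 : 0 < k%:R ^+ n :> R by rewrite exprn_gt0.
have part1 : (k ^ n %/ D)%:R <= (k%:R / (k%:R - 1) + e / 2) * (k%:R ^+ n / n%:R).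
  apply: (@le_trans _ _ (k%:R ^+ n / D%:R)).
    rewrite ler_pdivlMr // -natrM -natrX ler_nat; exact: leq_divM.
  rewrite mulrCA ler_pM2l //.
  apply: (@le_trans _ _ ((p - 2 * d)^-1 / n%:R)).
    by rewrite -invfM lef_pV2 ?posrE // ?mulr_gt0 //; lra.
  rewrite ler_pM2r ?invr_gt0 //.
  have -> : k%:R / (k%:R - 1) = p^-1 by rewrite /p invf_div kE addrK.
  have pp : p * p^-1 = 1 by rewrite mulfV // gt_eqF //; lra.
  have pi2 : p^-1 <= 2 by rewrite -[p^-1]mul1r ler_pdivrMr; lra.
  rewrite -[X in X <= _]mul1r ler_pdivrMr; last by lra.
  have : 0 <= d * (2 - p^-1) by rewrite mulr_ge0 ?(ltW d0) //; lra.
  have : 0 <= e / 2 * (p - 2 * d - 1 / 4) by rewrite mulr_ge0 //; lra.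
  by lra.
have part2 : #|small_support n dflt D|%:R <= e / 2 * (k%:R ^+ n / n%:R).
  apply: le_trans (@card_small_support_exp n D d _ Dle) _; first by rewrite d0; lra.
  rewrite [X in _ <= X]mulrCA ler_pM2l // -/a.
  rewrite ler_pdivlMr // expRN mulrC ler_pdivrMr ?expR_gt0 //.
  have sq : (n%:R * a) ^+ 2 / 4 <= expR (n%:R * a).
    have x0 : 0 <= n%:R * a by rewrite mulr_ge0 // ltW.
    have -> : n%:R * a = n%:R * a / 2 + n%:R * a / 2 by field.
    rewrite expRD; have := expR_ge1Dx (n%:R * a / 2); set u := expR _ => hu.
    by nra.
  have ea : 8 <= n%:R * (e * a ^+ 2).
    by rewrite -ler_pdivrMr // mulr_gt0 // exprn_gt0.
  have := ler_wpM2l (ltW e0) sq; have := ler_wpM2l (ltW n0) ea.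
  by move: (expR _) => u h1 h2; lra.
by rewrite natrD; apply: le_trans (lerD part1 part2) _; rewrite -mulrDl; lra.
Qed.

(** The good [D] depends on the tolerance [e]; minimizing over [D] gives one error term for all
    tolerances. The shift excludes [D = 0]. *)
Definition best_greedy_bound (n : nat) : nat :=
  greedy_bound n [arg min_(D < (ord0 : 'I_n.+1)) greedy_bound n D.+1].+1.

Lemma best_greedy_boundP (n D : nat) : (0 < D <= n.+1)%N ->
  (best_greedy_bound n <= greedy_bound n D)%N.
Proof.
move=> /andP[D0 Dn]; rewrite /best_greedy_bound; case: arg_minnP => // i _ /= h.
have Dn' : (D.-1 < n.+1)%N by rewrite prednK.
by have := h (Ordinal Dn') isT; rewrite /= prednK.
Qed.

(** With the positive part, only an upper estimate is needed for the little-o. *)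
Definition greedy_excess (n : nat) : R :=
  Num.max 0 ((best_greedy_bound n)%:R - k%:R / (k%:R - 1) * (k%:R ^+ n / n%:R)).

Lemma greedy_excess_littleo :
  greedy_excess =o_\oo (fun n : nat => k%:R ^+ n / n%:R : R).
Proof.
apply/eqoP => e e0; have [N hN] := greedy_bound_asympt e0.
exists N => // n /= /hN[D /andP[D0 Dn] hD].
have x0 : 0 <= k%:R ^+ n / n%:R :> R by rewrite divr_ge0 // exprn_ge0.
have hb : (best_greedy_bound n)%:R <= (greedy_bound n D)%:R :> R.
  by rewrite ler_nat; apply: best_greedy_boundP; rewrite D0 ltnW.
rewrite (ger0_norm x0) ger0_norm; last by rewrite le_max lexx.
by rewrite ge_max mulr_ge0 ?(ltW e0) //=; lra.
Qed.

End Asymptotics.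

Theorem theorem1 (R : realType) (k : nat) (hk : (2 <= k)%N) :
  exists eps : nat -> R,
    eps =o_\oo (fun n : nat => k%:R ^+ n / n%:R : R) /\
    forall (n : nat) (M : MDP R n k) (c : criterion R)
           (pi0 : policy n k) (run : seq (policy n k)),
      GPI_run M c pi0 run ->
      (size run)%:R <= k%:R / (k%:R - 1) * (k%:R ^+ n / n%:R) + eps n.
Proof.
pose dflt : 'I_k := Ordinal (ltnW hk).
exists (greedy_excess R dflt); split; first exact: greedy_excess_littleo.
move=> n M c pi0 run hrun; have [W ord] := improvement_order_exists M c.
have h : (size run <= best_greedy_bound dflt n)%N by apply: GPI_run_bound ord _ hrun.
rewrite -lerBlDl le_max; apply/orP; right; rewrite lerD2r.
by rewrite ler_nat.
Qed.
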